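(* For every integer $t\geq 4$, every graph that does not contain $K_t$ as a minor has a colouring with $t-1$ colours such that each monochromatic component has treewidth at most $t-3$.
   Context: All graphs are finite and simple. Colourings need not be proper; a monochromatic component is a connected component of the subgraph induced by the vertices of one colour. *)

(* Defs.v *)
(* MathComp; classical reasoning (boolp) is used only to turn a Prop into a
   predicate on nat when taking a minimum. *)
From mathcomp Require Import all_boot.
From mathcomp Require Import boolp.

Set Implicit Arguments.
Unset Strict Implicit.
Unset Printing Implicit Defensive.

Record sgraph := SGraph {
  vertex :> finType;
  edge : rel vertex;
  edge_sym : symmetric edge;
  edge_irrefl : irreflexive edge }.

Section Induced.
Variables (G : sgraph) (A : {set G}).

Definition induced_edge : rel {x : G | x \in A} := relpre val (@edge G).

Lemma induced_edge_sym : symmetric induced_edge.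
Proof. by move=> x y; apply: edge_sym. Qed.

Lemma induced_edge_irrefl : irreflexive induced_edge.
Proof. by move=> x; apply: edge_irrefl. Qed.

Definition induced : sgraph := SGraph induced_edge_sym induced_edge_irrefl.
End Induced.

Section Complete.
Variable n : nat.

Definition complete_edge : rel 'I_n := fun i j => i != j.

Lemma complete_edge_sym : symmetric complete_edge.
Proof. by move=> i j; rewrite /complete_edge eq_sym. Qed.

Lemma complete_edge_irrefl : irreflexive complete_edge.
Proof. by move=> i; rewrite /complete_edge eqxx. Qed.

Definition complete : sgraph := SGraph complete_edge_sym complete_edge_irrefl.
End Complete.

(* The graph without vertices is not connected. *)
Definition connected (G : sgraph) : Prop :=
  0 < #|G| /\ forall x y : G, connect (@edge G) x y.

(* Vertex sets of the connected components. *)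
Definition components (G : sgraph) : {set {set G}} :=
  [set [set y | connect (@edge G) x y] | x : G].

(* B is a model of H in G: its branch sets B i are nonempty (by the convention
   on connectedness), connected and pairwise disjoint. *)
Definition minor (H G : sgraph) : Prop :=
  exists B : H -> {set G},
    [/\ forall i, connected (induced (B i)),
        forall i j, i != j -> [disjoint B i & B j]
      & forall i j, edge i j ->
          exists x y, [/\ x \in B i, y \in B j & edge x y]].

(* The bound on the size excludes the closed walks x and x, y, which ucycle
   admits. *)
Definition acyclic (G : sgraph) : Prop :=
  forall c : seq G, 2 < size c -> ~ ucycle (@edge G) c.

Definition is_tree (G : sgraph) : Prop := connected G /\ acyclic G.

(* By the convention on connectedness, the last clause also says that every
   vertex lies in some bag. *)
Definition tree_decomposition (G T : sgraph) (bag : T -> {set G}) : Prop :=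
  [/\ is_tree T,
      forall u v : G, edge u v -> exists x, (u \in bag x) && (v \in bag x)
    & forall v : G, connected (induced [set x | v \in bag x])].

(* Predecessor is truncated: only the graph without vertices is affected, with
   width 0 instead of -1 when all bags are empty. *)
Definition width (G T : sgraph) (bag : T -> {set G}) : nat :=
  (\max_(x : T) #|bag x|).-1.

Definition has_width (G : sgraph) (k : nat) : Prop :=
  exists (T : sgraph) (bag : T -> {set G}),
    tree_decomposition bag /\ width bag = k.

Lemma ex_has_width (G : sgraph) : exists k, `[< has_width G k >].
Proof.
pose bag (x : complete 1) := [set: G].
exists (width bag); apply/asboolP; exists (complete 1), bag; split=> //; split.
- split; first by split=> [|x y]; rewrite ?card_ord // (ord1 x) (ord1 y).
  move=> c c2 /andP[_ /card_uniqP cU].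
  by move: (max_card (mem c)); rewrite card_ord cU leqNgt ltnW.
- by move=> u v _; exists ord0; rewrite !inE.
- move=> v; split=> [|[x x_v] [y y_v]].
    have x0 : (ord0 : complete 1) \in [set x | v \in bag x] by rewrite !inE.
    apply/card_gt0P.
    by exists (exist (fun x : complete 1 => x \in [set x | v \in bag x]) _ x0).
  suff -> : exist _ x x_v = exist _ y y_v :> induced _ by [].
  by apply: val_inj; rewrite /= (ord1 x) (ord1 y).
Qed.

Definition treewidth (G : sgraph) : nat := ex_minn (ex_has_width G).

Definition colour_class (G : sgraph) (k : nat) (c : G -> 'I_k) (i : 'I_k) :
  {set G} := [set v | c v == i].

(* Main.v *)
(* Cut off pieces greedily so that the pieces touching any component C of the
   rest are pairwise adjacent. Together with C they form a clique minor, so there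
   are at most t - 2 of them. Inside C, the next piece is a minimal connected set
   H containing a neighbour of each of them: it gets a colour that they do not
   use, and pieces touching what remains of C are still pairwise adjacent. Each
   monochromatic component then lies in a single piece.
   A vertex w of H that is not one of the chosen neighbours is a cutvertex, and
   each component of H - w contains a chosen neighbour. Sending each vertex of a
   block to a chosen neighbour which is itself or lies behind it shows that blocks
   have at most t - 2 vertices, so H has treewidth at most t - 3. The block
   decomposition is obtained by removing end blocks one at a time. *)
Require Import Defs.
From mathcomp Require Import all_boot.
From mathcomp Require Import boolp.

Set Implicit Arguments.
Unset Strict Implicit.
Unset Printing Implicit Defensive.

(** * Connected vertex sets and adjacency between them *)

Section Connectivity.
Variable G : sgraph.
Implicit Types (x y z v w : G) (A B C D H S X Y : {set G}).

(** Only the trace of [X] on [A] matters, so one [X] can be tested against several sets [A]. *)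
Definition edge_closed A X : Prop :=
  forall x y, x \in A -> y \in A -> edge x y -> x \in X -> y \in X.

(* Connectedness of the subgraph induced by A, phrased without paths. *)
Definition conn A : Prop :=
  A != set0 /\
  forall X, edge_closed A X -> forall x, x \in A -> x \in X -> A \subset X.

Definition adjacent A B : bool := [exists x in A, exists y in B, edge x y].

Lemma adjacentP A B :
  reflect (exists x y, [/\ x \in A, y \in B & edge x y]) (adjacent A B).
Proof.
apply: (iffP exists_inP) => [[x xA /exists_inP[y yB xy]]|[x [y [xA yB xy]]]].
  by exists x, y.
by exists x => //; apply/exists_inP; exists y.
Qed.

Lemma adjacentC A B : adjacent A B = adjacent B A.
Proof.
by apply/adjacentP/adjacentP => -[x [y [xA yB xy]]];
  exists y, x; rewrite edge_sym.
Qed.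

Lemma adjacentSS A A' B B' :
  A \subset A' -> B \subset B' -> adjacent A B -> adjacent A' B'.
Proof.
move=> /subsetP sA /subsetP sB /adjacentP[x [y [xA yB xy]]].
by apply/adjacentP; exists x, y; rewrite sA ?sB.
Qed.

Lemma conn1 x : conn [set x].
Proof.
split=> [|X _ y /set1P-> yX]; first by rewrite -card_gt0 cards1.
by rewrite sub1set.
Qed.

(** Serves for sets sharing a vertex and for sets joined by an edge: a closed set fills the side it
    meets, crosses between [x] and [y], and fills the other. *)
Lemma connU A B x y :
  conn A -> conn B -> x \in A -> y \in B -> x = y \/ edge x y ->
  conn (A :|: B).
Proof.
move=> [A0 cA] [B0 cB] xA yB xy; split.
  by rewrite -card_gt0; apply/card_gt0P; exists x; rewrite inE xA.
move=> X cX z zAB zX.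
have clA : edge_closed A X.
  by move=> a b aA bA; apply: cX; rewrite inE ?aA ?bA.
have clB : edge_closed B X.
  by move=> a b aA bA; apply: cX; rewrite inE ?aA ?bA orbT.
rewrite subUset.
move: zAB; rewrite inE => /orP[zA|zB].
  have sA := cA X clA z zA zX; rewrite sA (cB X clB y) //.
  case: xy => [<-|xy]; first exact: (subsetP sA).
  by apply: cX xy _; rewrite ?inE ?xA ?yB ?orbT //; apply: (subsetP sA).
have sB := cB X clB z zB zX; rewrite sB (cA X clA x) //.
case: xy => [->|xy]; first exact: (subsetP sB).
rewrite edge_sym in xy.
by apply: cX xy _; rewrite ?inE ?xA ?yB ?orbT //; apply: (subsetP sB).
Qed.

(** The complement in [A] of a closed set is closed, so it suffices to test the closed sets that
    miss [z]. *)
Lemma conn_from z A :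
  z \in A ->
  (forall X, X \subset A -> edge_closed A X -> z \notin X -> X = set0) ->
  conn A.
Proof.
move=> zA hz; split; first by apply/set0Pn; exists z.
move=> X cX x xA xX; have [zX|zX] := boolP (z \in X).
  rewrite -setD_eq0; apply/eqP/hz; first exact: subsetDl.
    move=> a b aA bA ab; rewrite !inE aA bA !andbT.
    by apply: contra; apply: cX => //; rewrite edge_sym.
  by rewrite inE zX.
suff /setP/(_ x) : A :&: X = set0 by rewrite !inE xA xX.
apply: hz; first exact: subsetIl.
  by move=> a b aA bA ab; rewrite !inE aA bA /=; apply: cX.
by rewrite inE (negPf zX) andbF.
Qed.

Lemma not_conn z A :
  z \in A -> ~ conn A ->
  exists X, [/\ X \subset A, edge_closed A X, z \notin X & X != set0].
Proof.
move=> zA nA; apply: contrapT => nX; apply: nA; apply: (conn_from zA).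
move=> X sX cX zX; apply: contrapT => /eqP X0; apply: nX.
by exists X.
Qed.

Lemma conn_connected : conn [set: G] -> connected G.
Proof.
move=> [G0 cG]; split; first by rewrite -cardsT card_gt0.
move=> x y; have : [set: G] \subset [set y | connect (@edge G) x y].
  apply: (cG _ _ x); rewrite ?inE // => a b _ _ ab; rewrite !inE => xa.
  exact: connect_trans xa (connect1 ab).
by move/subsetP/(_ y (in_setT y)); rewrite inE.
Qed.

End Connectivity.

Lemma conn_induced (G : sgraph) (A : {set G}) :
  conn A -> connected (induced A).
Proof.
move=> [/set0Pn[a aA] cA]; apply: conn_connected; split.
  by apply/set0Pn; exists (Sub a aA : induced A); rewrite inE.
move=> X cX x _ xX.
have sA : A \subset val @: X.
  apply: (cA _ _ (val x)) => [u v uA vA uv /imsetP[u' u'X eu]| |].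
  - apply/imsetP; exists (Sub v vA : induced A) => //.
    by apply: (cX u'); rewrite ?inE //; rewrite eu in uv.
  - exact: valP.
  - exact: imset_f.
apply/subsetP => y _.
have /imsetP[y' y'X ey] := subsetP sA _ (valP y).
by rewrite (val_inj ey).
Qed.

(** * Attaching a new leaf [None] to a tree at the vertex [r] *)

Section Leaf.
Variables (T : sgraph) (r : T).

Definition leaf_edge : rel (option T) := fun x y =>
  match x, y with
  | Some x, Some y => edge x y
  | Some x, None | None, Some x => x == r
  | None, None => false
  end.

Lemma leaf_edge_sym : symmetric leaf_edge.
Proof. by case=> [x|] [y|] //=; apply: edge_sym. Qed.

Lemma leaf_edge_irrefl : irreflexive leaf_edge.
Proof. by case=> //= x; apply: edge_irrefl. Qed.

Definition add_leaf : sgraph := SGraph leaf_edge_sym leaf_edge_irrefl.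

Lemma conn_Some (X : {set T}) :
  conn X -> conn ([set Some x | x in X] : {set add_leaf}).
Proof.
move=> [/set0Pn[x0 x0X] cX]; split.
  by apply/set0Pn; exists (Some x0); apply: imset_f.
move=> Y cY _ /imsetP[x xX ->] xY.
have /subsetP sX : X \subset [set z | (Some z : add_leaf) \in Y].
  apply: (cX _ _ x) => //; last by rewrite inE.
  move=> a b aX bX ab; rewrite !inE.
  by apply: cY; rewrite ?imset_f.
by apply/subsetP => _ /imsetP[z /sX + ->]; rewrite inE.
Qed.

Lemma conn_leaf (X : {set T}) :
  conn X -> r \in X ->
  conn ((None : add_leaf) |: [set Some x | x in X] : {set add_leaf}).
Proof.
move=> cX rX.
apply: (@connU add_leaf _ _ None (Some r)); rewrite ?inE ?imset_f //.
- exact: (@conn1 add_leaf).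
- exact: conn_Some.
- by right=> /=.
Qed.

(** A cycle avoiding [None] comes from [T]. In a cycle rotated to start at [None], the second and
    the last vertex would both be [r]. *)
Lemma acyclic_add_leaf : acyclic T -> acyclic add_leaf.
Proof.
move=> aT c c2 cc; have [Nc|Nc] := boolP ((None : add_leaf) \in c); last first.
  have ec : c = map Some (pmap id c).
    elim: c Nc {c2 cc} => //= -[x|] c IH; rewrite inE //= => Nc.
    by rewrite -IH.
  apply: (aT (pmap id c)); first by rewrite -(size_map Some) -ec.
  move: cc; rewrite ec /ucycle map_inj_uniq; last by move=> ? ? [].
  case/andP=> cc uc; rewrite -ec in cc *; apply/andP; split=> //.
  move: cc; rewrite {1}ec; case: (pmap id c) => //= x s.
  by rewrite -map_rcons path_map.
have [i s es] := rot_to Nc.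
have : ucycle (@edge add_leaf) (rot i c) by rewrite /ucycle rot_cycle rot_uniq.
have : size (rot i c) > 2 by rewrite size_rot.
rewrite es {es}; case: s => [|x s] //=; case: (lastP s) => [|s' y] //= _.
rewrite /ucycle /= rcons_path last_rcons => /andP[/and3P[ex _ ey]].
case: x ex => // x /eqP->; case: y ey => // y /eqP->.
by rewrite mem_rcons !inE eqxx /= andbF.
Qed.

End Leaf.

(** Stated for a subset of [G] to avoid subtypes. Bags stay inside [A], so that vertices outside [A]
    can be added later in a single new bag. [k] bounds the bag sizes, hence is one more than a bound
    on the width. *)
Inductive tree_decomposable (G : sgraph) (A : {set G}) (k : nat) : Prop :=
  TreeDecomposable (T : sgraph) (bag : T -> {set G}) of
    conn [set: T]
  & acyclic T
  & (forall u v, u \in A -> v \in A -> edge u v ->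
      exists x, (u \in bag x) && (v \in bag x))
  & (forall v, v \in A -> conn [set x | v \in bag x])
  & (forall x, bag x \subset A)
  & (forall x, #|bag x| <= k).

(** * Block decomposition of minimal connected sets *)

Section MinimalConnected.
Variable G : sgraph.
Implicit Types (v w x y z : G) (A B D H S X : {set G}).

(* D is a union of components of H - v. *)
Definition separation H v D : Prop :=
  [/\ v \in H, D \subset H :\ v
    & forall x y, x \in D -> y \in H -> edge x y -> y \in v |: D].

Lemma separationC H v D : separation H v D -> separation H v (H :\ v :\: D).
Proof.
move=> [vH sD cD]; split=> //; first exact: subsetDl.
move=> x y; rewrite !inE => /and3P[xD xv xH] yH xy; rewrite yH andbT.
case: eqVneq => //= yv; rewrite andbT; apply: contra xD => yD.
have := cD y x yD xH; rewrite edge_sym xy !inE => /(_ isT).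
by rewrite (negPf xv).
Qed.

(** A closed set of [H :\: D] missing [v] is closed in [H] too, since no edge of [H] joins it to
    [D]. *)
Lemma conn_separation H v D : conn H -> separation H v D -> conn (H :\: D).
Proof.
move=> [H0 cH] [vH /subsetP sD cD].
have vD : v \notin D by apply/negP => /sD; rewrite !inE eqxx.
apply: (@conn_from _ v); first by rewrite inE vH vD.
move=> X /subsetP sX cX vX; apply: contrapT => /eqP/set0Pn[x xX].
have xH : x \in H by have := sX x xX; rewrite inE => /andP[].
suff : H \subset X by move/subsetP/(_ v vH); apply/negP.
apply: (cH _ _ x) => // a b aH bH ab aX.
apply: (cX a) => //; first exact: sX.
rewrite inE bH andbT; apply/negP => bD.
have := cD b a bD aH; rewrite edge_sym ab !inE => /(_ isT) /orP[/eqP av|aD].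
  by rewrite -av aX in vX.
by have := sX a aX; rewrite inE aD.
Qed.

Definition minimal_conn H S : Prop :=
  [/\ conn H, S \subset H
    & forall X, conn X -> S \subset X -> X \subset H -> X = H].

Definition proper_separation H v D : Prop :=
  [/\ separation H v D, D != set0 & H :\ v :\: D != set0].

(** If [H :\ w] were connected, it would still contain [S], against minimality. *)
Lemma minimal_conn_cut H S w :
  minimal_conn H S -> S != set0 -> w \in H -> w \notin S ->
  exists X, proper_separation H w X.
Proof.
move=> [cH sS mH] /set0Pn[s sS'] wH wS.
have sw : s \in H :\ w.
  by rewrite !inE (subsetP sS) // andbT; apply: contraNneq wS => <-.
have nc : ~ conn (H :\ w).
  move=> cw; have /setP/(_ w) : H :\ w = H.
    apply: mH => //; last exact: subsetDl.
    apply/subsetP => z zS; rewrite !inE (subsetP sS) // andbT.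
    by apply: contraNneq wS => <-.
  by rewrite !inE eqxx wH.
have [X [sX cX zX X0]] := not_conn sw nc.
exists X; split=> //; last by apply/set0Pn; exists s; rewrite inE zX.
split=> // x y xX yH xy; rewrite !inE; case: eqVneq => //= yw.
by apply: (cX x) => //; [apply: (subsetP sX)|rewrite !inE yw].
Qed.

Lemma proper_separationC H v D :
  proper_separation H v D -> proper_separation H v (H :\ v :\: D).
Proof.
move=> [sH D0 D1]; split=> //; first exact: separationC.
have [_ sD _] := sH.
by rewrite setDDr setDv set0U (setIidPr sD).
Qed.

(* A side X of a cut at w in D yields a cut with a smaller side inside D, so the
   smallest sides consist of elements of S only. *)
Lemma separation_shrink H v D w X :
  conn H -> separation H v D -> w \in D ->
  separation H w X -> X != set0 -> v \notin X ->
  [/\ separation H w (X :&: D), X :&: D != set0 & X :&: D \proper D].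
Proof.
move=> [_ cH] [vH /subsetP sD cD] wD [wH /subsetP sX cX] /set0Pn[x xX] vX.
have wX : w \notin X by apply/negP => /sX; rewrite !inE eqxx.
have XH z : z \in X -> z \in H by move/sX; rewrite inE => /andP[].
split.
- split=> //.
    by apply/subsetP => z /setIP[/sX].
  move=> a b /setIP[aX aD] bH ab.
  have := cX a b aX bH ab; have := cD a b aD bH ab.
  rewrite !inE; case: (b == w) => //=.
  by case/predU1P=> [->|->]; rewrite ?(negPf vX) // => ->.
(* If [X] missed [D], no edge could lead from [X] to [w], whose neighbours in [H] lie in [v |: D];
   then [X] would be closed in [H] and contain [v]. *)
- apply: contraNneq (vX) => XD.
  apply: (subsetP (cH X _ x _ xX)) => //; last exact: XH.
  move=> a b _ bH ab aX; have := cX a b aX bH ab.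
  rewrite !inE => /predU1P[bw|//]; subst b.
  have := cD w a wD (XH a aX); rewrite edge_sym ab !inE => /(_ isT).
  case/predU1P => [av|aD]; first by rewrite -av aX in vX.
  by have /setP/(_ a) := XD; rewrite !inE aX aD.
- apply/properP; split; first exact: subsetIr.
  by exists w => //; rewrite inE (negPf wX).
Qed.

Lemma minimal_proper_separation H S :
  minimal_conn H S -> S != set0 ->
  (exists v D, proper_separation H v D) ->
  exists v D, proper_separation H v D /\ D \subset S.
Proof.
move=> mH S0 [v [D]]; have [n] := ubnP #|D|.
elim: n v D => // n IH v D ltD pD.
have [DS|/subsetPn[w wD wS]] := boolP (D \subset S); first by exists v, D.
have [[vH sD cD] D0 D1] := pD; have [cH _ _] := mH.
have /setD1P[_ wH] : w \in H :\ v by exact: (subsetP sD).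
have wv : v != w.
  by apply: contraTneq wD => <-; apply/negP => /(subsetP sD); rewrite !inE eqxx.
(* Of the two sides of a cut at [w], take the one that misses [v]. *)
suff [X [pX vX]] : exists X, proper_separation H w X /\ v \notin X.
  have [sX X0 _] := pX.
  have [s1 s2 s3] := separation_shrink cH (And3 vH sD cD) wD sX X0 vX.
  apply: (IH w (X :&: D)); first exact: leq_trans (proper_card s3) _.
  split=> //; apply/set0Pn; exists v.
  by rewrite !inE (negPf vX) wv vH.
have [X pX] := minimal_conn_cut mH S0 wH wS.
have [vX|vX] := boolP (v \in X); last by exists X.
exists (H :\ w :\: X); split; first exact: proper_separationC.
by rewrite inE vX.
Qed.

(* Some element of S lies outside v |: D, as v |: D is connected: hence the strict
   inequality, which leaves room for v in the bag of the end block v |: D. *)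
Lemma minimal_conn_block H S v D :
  minimal_conn H S -> proper_separation H v D -> D \subset S ->
  #|D| < #|S| /\ minimal_conn (H :\: D) (v |: S :\: D).
Proof.
move=> [cH sS mH] pD DS; have [sep D0 D1] := pD; have [vH sD cD] := sep.
have [sepC _ _] := proper_separationC pD.
have vD : v \notin D by apply/negP => /(subsetP sD); rewrite !inE eqxx.
have DH : D \subset H := subset_trans sD (subsetDl _ _).
(* [v |: D] is what remains of [H] once the opposite side is removed. *)
have cvD : conn (v |: D).
  have := conn_separation cH sepC.
  congr conn; apply/setP => z; rewrite !inE.
  case: eqVneq => [->|_] /=; first by rewrite vH andbF.
  case: (boolP (z \in H)) => zH; rewrite ?andbT ?negbK ?andbF //=.
  by apply/esym/negbTE; apply: contra zH => /(subsetP DH).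
split.
  apply: proper_card; rewrite properE DS; apply/negP => SD.
  have /setP e : v |: D = H.
    apply: mH => //; first by apply: subset_trans SD _; apply: subsetUr.
    by rewrite subUset sub1set vH.
  case/set0Pn: D1 => z; rewrite !inE => /and3P[zD zv zH].
  by have := e z; rewrite !inE zH (negPf zD) (negPf zv).
split; first exact: conn_separation sep.
  rewrite subUset sub1set inE vH vD /=; exact: setSD.
move=> X cX sX XH; have vX : v \in X.
  by apply: (subsetP sX); rewrite !inE eqxx.
(* Gluing the end block back at [v] gives a connected set containing [S]. *)
have e : X :|: (v |: D) = H.
  apply: mH.
  - by apply: (connU cX cvD vX (y := v)); [rewrite !inE eqxx|left].
  - apply/subsetP => s sS'; rewrite !inE.
    have [|sD'] := boolP (s \in D); first by rewrite !orbT.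
    by rewrite (subsetP sX) // !inE sD' sS' orbT.
  - rewrite !subUset sub1set vH DH !andbT.
    exact: subset_trans XH (subsetDl _ _).
apply/eqP; rewrite eqEsubset XH /=; apply/subsetP => z /setDP[].
rewrite -e !inE; case: eqVneq => [->|_] //=.
by case/orP=> // ->.
Qed.

Lemma tree_decomposable_trivial A : tree_decomposable A #|A|.
Proof.
have c1 : conn [set: complete 1].
  have -> : [set: complete 1] = [set ord0].
    by apply/setP => x; rewrite !inE (ord1 x) eqxx.
  exact: conn1.
apply: (@TreeDecomposable G A #|A| (complete 1) (fun=> A)) => //.
- move=> c c2 /andP[_ /card_uniqP cU].
  by move: (max_card (mem c)); rewrite card_ord cU leqNgt ltnW.
- by move=> u v uA vA _; exists ord0; rewrite uA.
- move=> v vA; have -> // : [set x : complete 1 | v \in A] = setT.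
  by apply/setP => x; rewrite !inE.
Qed.

(** A leaf with bag [v |: D] is attached to a node whose bag contains [v]; this bag covers all edges
    of [H] that meet [D]. *)
Lemma tree_decomposable_leaf H v D k :
  separation H v D -> tree_decomposable (H :\: D) k -> #|D| < k ->
  tree_decomposable H k.
Proof.
move=> [vH sD cD] [T bag cT aT eT vT sT kT] Dk.
have vD : v \notin D by apply/negP => /(subsetP sD); rewrite !inE eqxx.
have vHD : v \in H :\: D by rewrite inE vD.
have [/set0Pn[r]] := vT v vHD; rewrite inE => rv _.
pose nbag (x : add_leaf r) := if x is Some y then bag y else v |: D.
have bagD z (x : T) : z \in D -> z \notin bag x.
  by move=> zD; apply/negP => /(subsetP (sT x)); rewrite inE zD.
apply: (@TreeDecomposable G H k (add_leaf r) nbag).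
- have := conn_leaf cT (in_setT r).
  congr conn; apply/setP => -[x|]; rewrite !inE //=; exact: imset_f.
- exact: acyclic_add_leaf.
- move=> x y xH yH xy.
  have [xD|xD] := boolP (x \in D).
    by exists None; rewrite /= (cD x y) // !inE xD orbT.
  have [yD|yD] := boolP (y \in D).
    by exists None; rewrite /= (cD y x) // 1?edge_sym // !inE yD orbT.
  have [||//|z zxy] := eT x y; rewrite ?inE ?xD ?yD //.
  by exists (Some z).
(* Vertices of [D] occur only at the leaf, the subtree of [v] grows by the leaf, and all other
   subtrees are unchanged. *)
- move=> x xH; have [xD|xD] := boolP (x \in D).
    have := @conn1 (add_leaf r) None; congr conn; apply/setP => -[y|].
      by rewrite !inE (negPf (bagD _ _ _)).
    by rewrite !inE xD orbT.
  have /vT cx : x \in H :\: D by rewrite inE xD.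
  have [xv|xv] := eqVneq x v.
    subst x; have := conn_leaf (r := r) cx; rewrite inE => /(_ rv).
    congr conn; apply/setP => -[y|]; rewrite !inE ?eqxx //=.
    by rewrite mem_imset ?inE // => ? ? [].
  have := conn_Some r cx; congr conn; apply/setP => -[y|].
    by rewrite !inE /= mem_imset ?inE // => ? ? [].
  rewrite !inE (negPf xv) (negPf xD); apply/negbTE.
  by apply/imsetP => -[].
- case=> [x|] /=; first exact: subset_trans (sT x) (subsetDl _ _).
  by rewrite subUset sub1set vH (subset_trans sD (subsetDl _ _)).
- by case=> [x|] //=; rewrite cardsU1 vD.
Qed.

Lemma tree_decomposable_leq A k l :
  k <= l -> tree_decomposable A k -> tree_decomposable A l.
Proof.
move=> kl [T bag cT aT eT vT sT kT]; apply: (TreeDecomposable cT aT eT vT sT).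
by move=> x; apply: leq_trans (kT x) kl.
Qed.

(** Induction on [#|H|]: an end block is split off if there is a cutvertex; otherwise [H = S] and
    one bag suffices. *)
Lemma minimal_conn_tree_decomposable H S :
  minimal_conn H S -> S != set0 -> tree_decomposable H #|S|.
Proof.
have [n] := ubnP #|H|; elim: n H S => // n IH H S Hn mH S0.
have [sep|nosep] := pselect (exists v D, proper_separation H v D).
  have [v [D [pD DS]]] := minimal_proper_separation mH S0 sep.
  have [DltS mHD] := minimal_conn_block mH pD DS.
  have [sepD D0 _] := pD; have [_ sD _] := sepD.
  apply: (tree_decomposable_leaf sepD) => //.
  (* Adding [v] is paid for by removing the nonempty [D] from [S]. *)
  apply: (@tree_decomposable_leq _ #|v |: S :\: D|).
    apply: leq_trans (leq_card_setU _ _) _; rewrite cards1 cardsDS //.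
    by rewrite add1n ltn_subrL !card_gt0 D0.
  apply: IH => //; last by apply/set0Pn; exists v; rewrite !inE eqxx.
  rewrite -ltnS; apply: leq_trans Hn; rewrite ltnS; apply: proper_card.
  rewrite properE subsetDl; case/set0Pn: D0 => d dD.
  apply/subsetPn; exists d; last by rewrite inE dD.
  by have /setD1P[] := subsetP sD d dD.
have [_ sS _] := mH.
have -> : H = S.
  apply/eqP; rewrite eqEsubset sS andbT; apply/subsetP => w wH.
  apply: contrapT => /negP wS; apply: nosep.
  by have [X pX] := minimal_conn_cut mH S0 wH wS; exists w, X.
exact: tree_decomposable_trivial.
Qed.

End MinimalConnected.

(** * Passing from vertex sets to treewidth and to clique minors *)

Lemma treewidth_embedding (G G' : sgraph) (A : {set G}) (f : G' -> G) k :
  injective f -> (forall u, f u \in A) ->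
  (forall u v, edge u v -> edge (f u) (f v)) ->
  tree_decomposable A k -> treewidth G' <= k.-1.
Proof.
move=> fI fA fE [T bag cT aT eT vT _ kT].
(* Bags are pulled back along a map, since a monochromatic component is a subtype of a subtype. *)
pose bag' x := f @^-1: bag x.
rewrite /treewidth; case: ex_minnP => m _ /(_ (width bag')) mP.
apply: leq_trans (mP _) _.
  apply/asboolP; exists T, bag'; split=> //; split.
  - by split=> //; apply: conn_connected.
  - move=> u v uv; have [x] := eT _ _ (fA u) (fA v) (fE _ _ uv).
    by exists x; rewrite !inE.
  - move=> v; have := conn_induced (vT _ (fA v)).
    congr (connected (induced _)); apply/setP => x; by rewrite !inE.
rewrite /width -!subn1 leq_sub2r //; apply/bigmax_leqP => x _.
apply: leq_trans (kT x); rewrite -(card_imset _ fI).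
by apply/subset_leq_card/subsetP => _ /imsetP[u + ->]; rewrite inE.
Qed.

Lemma clique_minor (G : sgraph) (K : {set {set G}}) (t : nat) :
  (forall A, A \in K -> conn A) ->
  {in K &, forall A B : {set G}, A != B -> [disjoint A & B] /\ adjacent A B} ->
  t <= #|K| -> minor (complete t) G.
Proof.
move=> cK aK tK.
pose B (i : complete t) := enum_val (widen_ord tK i).
have BK i : B i \in K by apply: enum_valP.
have BI i j : i != j -> B i != B j.
  apply: contraNneq => /enum_val_inj e.
  by apply/eqP/val_inj; apply: (congr1 val e).
exists B; split=> [i|i j /BI ij|i j /BI ij].
- exact/conn_induced/cK.
- by have [] := aK _ _ (BK i) (BK j) ij.
- by have [_ /adjacentP] := aK _ _ (BK i) (BK j) ij.
Qed.

(** * Greedy partition into pieces, where [k] stands for t - 2 *)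

Section CliquePartition.
Variables (G : sgraph) (k : nat).
Implicit Types (x y : G) (A B C D P Q S H : {set G}) (F N : {set {set G}}).

(* A connected set avoiding the pieces stands for a component of the rest: the
   pieces it touches form a clique minor with it. *)
Definition clique_partition F (col : {set G} -> 'I_k.+1) : Prop :=
  [/\ forall P, P \in F -> conn P /\ tree_decomposable P k,
      {in F &, forall P Q : {set G}, P != Q -> [disjoint P & Q]},
      {in F &, forall P Q : {set G}, P != Q -> adjacent P Q -> col P != col Q}
    & forall C, conn C -> [disjoint C & cover F] ->
      {in F &, forall P Q : {set G}, P != Q -> adjacent C P -> adjacent C Q ->
        adjacent P Q}].

Lemma representatives C N :
  0 < k -> C != set0 -> (forall P, P \in N -> adjacent C P) -> #|N| <= k ->
  exists S, [/\ S \subset C, S != set0, #|S| <= k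
    & forall H, S \subset H -> forall P, P \in N -> adjacent H P].
Proof.
move=> k0 /set0Pn[c cC] aN Nk.
have [N0|/set0Pn[P0 P0N]] := eqVneq N set0.
  (* When no piece is touched, an arbitrary vertex keeps [S] nonempty; [0 < k] makes room for it. *)
  exists [set c]; rewrite sub1set cards1 -card_gt0 cards1; split=> //.
  by move=> H _ P; rewrite N0 inE.
pose f P := odflt c [pick x in C | [exists y in P, edge x y]].
have fP P : P \in N -> f P \in C /\ exists2 y, y \in P & edge (f P) y.
  move=> /aN/adjacentP[x [y [xC yP xy]]]; rewrite /f; case: pickP => /=.
    by move=> z /andP[zC /exists_inP].
  by move/(_ x); rewrite xC; case/exists_inP; exists y.
exists (f @: N); split.
- by apply/subsetP => _ /imsetP[P PN ->]; have [] := fP P PN.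
- by apply/set0Pn; exists (f P0); apply: imset_f.
- exact: leq_trans (leq_imset_card _ _) Nk.
- move=> H sH P PN; have [_ [y yP fy]] := fP P PN.
  by apply/adjacentP; exists (f P), y; rewrite (subsetP sH) ?imset_f.
Qed.

Lemma minimal_conn_exists C S :
  conn C -> S \subset C -> exists2 H, minimal_conn H S & H \subset C.
Proof.
move=> cC sC; pose p X := `[< conn X >] && (S \subset X).
have [|H /minsetP[/andP[/asboolP cH SH] mH] HC] := @minset_exists _ p C.
  by rewrite /p sC andbT; apply/asboolP.
exists H => //; split=> // X cX SX XH; apply: mH => //.
by rewrite /p SX andbT; apply/asboolP.
Qed.

Lemma fresh_colour N (col : {set G} -> 'I_k.+1) :
  #|N| <= k -> exists i, forall P, P \in N -> col P != i.
Proof.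
move=> Nk; have /subsetPn[i _ iN] : ~~ ([set: 'I_k.+1] \subset col @: N).
  apply/negP => /subset_leq_card; rewrite cardsT card_ord leqNgt.
  by rewrite ltnS (leq_trans (leq_imset_card _ _) Nk).
by exists i => P PN; apply: contraNneq iN => <-; apply: imset_f.
Qed.

Lemma clique_partition_extend F col :
  0 < k -> ~ minor (complete k.+2) G ->
  clique_partition F col -> cover F != [set: G] ->
  exists F' col', clique_partition F' col' /\ #|~: cover F'| < #|~: cover F|.
Proof.
move=> k0 nK [tF dF colF aF] covF.
have /subsetPn[x0 _ x0F] : ~~ ([set: G] \subset cover F) by rewrite subTset.
pose free X := `[< conn X >] && [disjoint X & cover F].
(* A maximal connected set of uncovered vertices is a component of the rest. *)
have [|C /maxsetP[/andP[/asboolP cC dC] mC] _] :=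
  @maxset_exists _ free [set x0].
  rewrite /free disjoints1 x0F andbT; apply/asboolP; exact: conn1.
have C0 : C != set0 by case: cC.
pose N := [set P in F | adjacent C P].
have NF P : P \in N -> P \in F by rewrite inE => /andP[].
have aN P : P \in N -> adjacent C P by rewrite inE => /andP[].
have dCF P : P \in F -> [disjoint C & P].
  by move=> PF; apply: disjointWr dC; apply: (bigcup_sup P).
(* Otherwise [C] and the pieces in [N] give at least [k.+2] branch sets. *)
have Nk : #|N| <= k.
  rewrite leqNgt; apply/negP => kN; apply: nK.
  have CN : C \notin N.
    apply/negP => /NF/dCF; rewrite -setI_eq0 setIid; exact/negP.
  apply: (@clique_minor _ (C |: N)); last by rewrite cardsU1 CN.
    by move=> P /setU1P[->//|/NF/tF[]].
  move=> P Q /setU1P[->|PN] /setU1P[->|QN]; first by rewrite eqxx.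
  - by move=> _; split; [apply/dCF/NF|apply: aN].
  - by move=> _; rewrite disjoint_sym adjacentC; split; [apply/dCF/NF|apply: aN].
  - move=> PQ; split; first by apply: dF => //; apply: NF.
    by apply: (aF C) => //; [apply: NF|apply: NF|apply: aN|apply: aN].
have [S [SC S0 Sk aS]] := representatives k0 C0 aN Nk.
have [H mH HC] := minimal_conn_exists cC SC.
have [cH SH _] := mH.
have [i iN] := fresh_colour col Nk.
have HF P : P \in F -> [disjoint H & P].
  by move=> /dCF; apply: disjointWl.
have [/set0Pn[h hH] _] := cH.
have HnF : H \notin F.
  by apply/negP => /HF /pred0P/(_ h); rewrite /= hH.
have covH : cover (H |: F) = H :|: cover F.
  by rewrite /cover bigcup_setU big_set1.
exists (H |: F), (fun P => if P == H then i else col P); split; last first.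
  apply: proper_card; rewrite covH properE setCS subsetUr setCS.
  apply/subsetPn; exists h; first by rewrite inE hH.
  by rewrite (disjointFr dC (subsetP HC h hH)).
have neH P : P \in F -> P != H by move=> PF; apply: contraNneq HnF => <-.
(* Hence the colour [i], fresh for [N], differs from that of every piece adjacent to [H]. *)
have HN P : P \in F -> adjacent H P -> P \in N.
  by move=> PF; rewrite inE PF; apply: adjacentSS HC _.
split.
- move=> P /setU1P[->|/tF//]; split=> //.
  exact: tree_decomposable_leq Sk (minimal_conn_tree_decomposable mH S0).
- move=> P Q /setU1P[->|PF] /setU1P[->|QF]; first by rewrite eqxx.
  + by move=> _; apply: HF.
  + by move=> _; rewrite disjoint_sym; apply: HF.
  + exact: dF.
- move=> P Q /setU1P[->|PF] /setU1P[->|QF]; first by rewrite eqxx.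
  + move=> _ /HN-/(_ QF) QN; rewrite eqxx (negPf (neH Q QF)) eq_sym.
    exact: iN.
  + rewrite adjacentC => _ /HN-/(_ PF) PN; rewrite eqxx (negPf (neH P PF)).
    exact: iN.
  + by rewrite !(negPf (neH _ _)) //; apply: colF.
move=> D cD; rewrite covH => dD.
have dDF : [disjoint D & cover F] by apply: disjointWr dD; apply: subsetUr.
(* By maximality of [C]. So the old pieces touched by [D] are in [N], and [H] touches them through
   [S]. *)
have DC : adjacent D H -> D \subset C.
  case/adjacentP => x [y [xD yH xy]].
  rewrite -(mC (C :|: D)) ?subsetUl ?subsetUr //.
  apply/andP; split; last by rewrite -setI_eq0 setIUl setU_eq0 !setI_eq0 dC.
  apply/asboolP; apply: (connU cC cD (subsetP HC y yH) xD).
  by right; rewrite edge_sym.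
have DN Q : Q \in F -> adjacent D H -> adjacent D Q -> adjacent H Q.
  move=> QF /DC sD DQ; apply: aS => //; rewrite inE QF.
  exact: adjacentSS sD _ DQ.
move=> P Q /setU1P[->|PF] /setU1P[->|QF]; first by rewrite eqxx.
- by move=> _; apply: DN.
- by move=> _ DP DH; rewrite adjacentC; apply: DN.
- exact: aF.
Qed.

(** Extension is iterated from the empty partition, by induction on a bound for the number of
    uncovered vertices. *)
Lemma clique_partition_exists :
  0 < k -> ~ minor (complete k.+2) G ->
  exists F col, clique_partition F col /\ cover F = [set: G].
Proof.
move=> k0 nK.
suff loop n F col : #|~: cover F| <= n -> clique_partition F col ->
    exists F col, clique_partition F col /\ cover F = [set: G].
  apply: (loop _ set0 (fun=> ord0) (leqnn _)).
  by split=> [P|P Q|P Q|C _ _ P Q]; rewrite inE.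
elim: n F col => [|n IH] F col.
  rewrite leqn0 cards_eq0 => /eqP FT cF; exists F, col; split=> //.
  by rewrite -[cover F]setCK FT setC0.
have [FT _ cF|FT Fn cF] := eqVneq (cover F) [set: G]; first by exists F, col.
have [F' [col' [cF' ltF]]] := clique_partition_extend k0 nK cF FT.
by apply: (IH F' col') => //; rewrite -ltnS (leq_trans ltF).
Qed.

End CliquePartition.

(** * Colouring each vertex by the colour of its piece *)

Theorem theorem14 (t : nat) (ht : 4 <= t) (G : sgraph)
    (hG : ~ minor (complete t) G) :
  exists c : G -> 'I_(t - 1),
    forall (i : 'I_(t - 1)) (C : {set induced (colour_class c i)}),
      C \in components (induced (colour_class c i)) ->
      treewidth (induced C) <= t - 3.
Proof.
case: t ht hG => [|[|[|k]]] // ht hG.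
rewrite !subSS !subn0.
(* Now t is [k.+3]: there are [k.+2] colours, and bags have at most [k.+1] vertices. *)
have [F [col [[tF dF colF _] covF]]] := @clique_partition_exists G k.+1 isT hG.
pose c v := col (pblock F v).
exists c => i C /imsetP[x _ ->{C}].
have blockF v : pblock F v \in F by rewrite pblock_mem // covF inE.
have inblock v : v \in pblock F v by rewrite mem_pblock covF inE.
have blockE (u v : induced (colour_class c i)) :
    edge u v -> pblock F (val u) = pblock F (val v).
  move=> uv; apply: contrapT => /eqP ne.
  have := valP u; have := valP v; rewrite !inE => /eqP cv /eqP cu.
  have : c (val u) != c (val v).
    by apply: colF => //; apply/adjacentP; exists (val u), (val v).
  by rewrite cu cv eqxx.
have [_ tP] := tF _ (blockF (val x)).
set C := [set y | _]; pose f (u : induced C) : G := val (val u).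
apply: (treewidth_embedding (f := f) _ _ _ tP) => //.
  by move=> u v /val_inj/val_inj.
move=> u; rewrite /f; have := valP u; rewrite inE => /connectP[p].
(* By [blockE] the piece is constant along a path in the colour class. *)
elim: p (x) => [|z p IH] y /=; first by move=> _ ->.
by case/andP=> /blockE-> pz eu; apply: IH pz eu.
Qed.
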